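(* If $\mathcal B$ is an AW$^*$-factor, then the identity map $\iota:\mathcal B\rightarrow\mathcal B$ is a pure element of $\mathcal{CP}(\mathcal B)$.
   Context: An AW$^*$-algebra is a (unital) C$^*$-algebra in which the left annihilator (equivalently, the right annihilator) of every nonempty subset is generated by a projection, and an AW$^*$-factor is an AW$^*$-algebra whose centre is $\mathbb C1$. $\mathcal{CP}(\mathcal B)$ denotes the convex cone of completely positive linear maps $\mathcal B\to\mathcal B$. An element $\phi\in\mathcal{CP}(\mathcal B)$ is pure if, whenever $\vartheta,\omega\in\mathcal{CP}(\mathcal B)$ satisfy $\vartheta+\omega=\phi$, there is $s\in[0,1]$ with $\vartheta=s\phi$ and $\omega=(1-s)\phi$. *)

(* Defs.v *)
(* The complex numbers are R[i] for R : realType. *)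
From HB Require Import structures.
From mathcomp Require Import all_boot all_order all_algebra.
From mathcomp Require Import complex.
From mathcomp Require Import all_classical all_reals all_analysis.

Set Implicit Arguments.
Unset Strict Implicit.
Unset Printing Implicit Defensive.

Import Order.TTheory GRing.Theory Num.Theory.
Import numFieldNormedType.Exports.

Local Open Scope classical_set_scope.
Local Open Scope ring_scope.

(* Nonzero unital C*-algebras. The product is a field of the record because the
   hierarchy has no join of CompleteNormedModule and GRing.Algebra. *)
Record cstarAlgType (R : realType) := CStarAlgType {
  cstar_module : completeNormedModType R[i];
  cstar_one : cstar_module;
  cstar_mul : cstar_module -> cstar_module -> cstar_module;
  cstar_star : cstar_module -> cstar_module;
  cstar_mulA : associative cstar_mul;
  cstar_mul1l : left_id cstar_one cstar_mul;
  cstar_mul1r : right_id cstar_one cstar_mul;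
  cstar_mulDl : left_distributive cstar_mul +%R;
  cstar_mulDr : right_distributive cstar_mul +%R;
  cstar_one_neq0 : cstar_one != 0;
  cstar_scaleAl : forall (a : R[i]) x y,
    a *: cstar_mul x y = cstar_mul (a *: x) y;
  cstar_scaleAr : forall (a : R[i]) x y,
    a *: cstar_mul x y = cstar_mul x (a *: y);
  cstar_starK : involutive cstar_star;
  cstar_starD : forall x y, cstar_star (x + y) = cstar_star x + cstar_star y;
  cstar_starZ : forall (a : R[i]) x, cstar_star (a *: x) = a^* *: cstar_star x;
  cstar_starM : forall x y,
    cstar_star (cstar_mul x y) = cstar_mul (cstar_star y) (cstar_star x);
  cstar_norm_mul : forall x y, `|cstar_mul x y| <= `|x| * `|y|;
  cstar_norm_star_mul : forall x, `|cstar_mul (cstar_star x) x| = `|x| ^+ 2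
}.

(* The carrier is a separate constant so that it can bear both the
   CompleteNormedModule and the GRing.Algebra canonical structures. *)
Definition cstar_sort (R : realType) (B : cstarAlgType R) : Type :=
  cstar_module B.

Coercion cstar_sort : cstarAlgType >-> Sortclass.

Section CStarInstances.
Context (R : realType) (B : cstarAlgType R).

HB.instance Definition _ :=
  CompleteNormedModule.copy (cstar_sort B) (cstar_module B).

HB.instance Definition _ := GRing.Zmodule_isNzRing.Build (cstar_sort B)
  (@cstar_mulA R B) (@cstar_mul1l R B) (@cstar_mul1r R B)
  (@cstar_mulDl R B) (@cstar_mulDr R B) (@cstar_one_neq0 R B).

HB.instance Definition _ := GRing.Lmodule_isLalgebra.Build R[i] (cstar_sort B)
  (@cstar_scaleAl R B).

HB.instance Definition _ := GRing.Lalgebra_isAlgebra.Build R[i] (cstar_sort B)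
  (@cstar_scaleAr R B).

End CStarInstances.

Definition star {R : realType} {B : cstarAlgType R} : B -> B :=
  @cstar_star R B.

Section AWStar.
Context {R : realType} (B : cstarAlgType R).

Definition is_projection (p : B) : Prop := p * p = p /\ star p = p.

Definition left_annihilator (S : set B) : set B :=
  [set x | forall s, S s -> x * s = 0].

Definition left_ideal_gen (p : B) : set B := [set x * p | x in [set: B]].

Definition is_AWstar_algebra : Prop :=
  forall S : set B, S !=set0 ->
    exists2 p, is_projection p & left_annihilator S = left_ideal_gen p.

Definition centre : set B := [set z | forall x, z * x = x * z].

Definition is_AWstar_factor : Prop :=
  is_AWstar_algebra /\ centre = [set c%:A | c in [set: R[i]]].

End AWStar.

Section CompletelyPositive.
Context {R : realType} {B : cstarAlgType R}.

Definition mxstar n (X : 'M[B]_n) : 'M[B]_n := (map_mx star X)^T.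

(* X is a positive element of the C*-algebra M_n(B), i.e., X = Y^* Y. *)
Definition mxpositive n (X : 'M[B]_n) : Prop :=
  exists Y : 'M[B]_n, X = mxstar Y *m Y.

Definition CP : set (B -> B) :=
  [set phi | linear phi /\
     forall n (X : 'M[B]_n), mxpositive X -> mxpositive (map_mx phi X)].

(* Sums and scalar multiples of maps are those of the function space B -> B. *)
Definition pure_CP (phi : B -> B) : Prop :=
  CP phi /\
  forall theta omega : B -> B, CP theta -> CP omega -> theta + omega = phi ->
    exists s : R, [/\ 0 <= s <= 1,
      theta = s%:C%C *: phi & omega = (1 - s)%:C%C *: phi].

End CompletelyPositive.

(* Main.v *)
(* If theta + omega is the identity, apply theta and omega to the matrix
   [x_i^* x_j] with (x_0, x_1) = (1, x), and evaluate at the column (x, -1), which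
   annihilates it. Both images are positive and their values at this column add up
   to 0, so each of them annihilates it, and this reads theta(x) = theta(1) x. By
   symmetry theta(x) = x theta(1) as well, hence theta(1) is central, i.e., a
   scalar.

   This uses that a sum of elements x^* x vanishes only if each x does, that is,
   that x^* x is positive. In place of the spectrum, strict positivity of a
   self-adjoint k is expressed as |T - k| < T for some real T: such elements form
   a cone and have square roots, by iterating s |-> (r + s^2) / 2, and these
   square roots give all the functional calculus that is needed. *)
Require Import Defs.
From mathcomp Require Import all_boot all_order all_algebra.
From mathcomp Require Import complex.
From mathcomp Require Import all_classical all_reals all_analysis.
From mathcomp Require Import lra.
From Stdlib Require Ncring Ncring_tac.

Set Implicit Arguments.
Unset Strict Implicit.
Unset Printing Implicit Defensive.

Import Order.TTheory GRing.Theory Num.Theory.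
Import numFieldNormedType.Exports.

Local Open Scope classical_set_scope.
Local Open Scope ring_scope.

Section CStar.
Context (R : realType) (B : cstarAlgType R).
Implicit Types (a b k p x y z : B) (s t T : R).

(** * Normalization of noncommutative ring identities in [B] *)

#[local] Instance cstar_ring_ops :
  @Ncring.Ring_ops B 0 1 +%R *%R (fun x y => x - y) -%R eq := {}.

#[local] Instance cstar_ring : Ncring.Ring (Ro := cstar_ring_ops).
Proof.
split=> //.
- exact: RelationClasses.eq_equivalence.
- by move=> ? ? -> ? ? ->.
- by move=> ? ? -> ? ? ->.
- by move=> ? ? -> ? ? ->.
- by move=> ? ? ->.
- exact: add0r.
- exact: addrC.
- exact: addrA.
- exact: mul1r.
- exact: mulr1.
- exact: mulrA.
- exact: mulrDl.
- by move=> *; exact: mulrDr.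
- exact: addrN.
Qed.

Ltac ncring := Ncring_tac.non_commutative_ring.

(** * Arithmetic of the involution and of central scalars *)

Lemma starK x : star (star x) = x. Proof. exact: cstar_starK. Qed.
Lemma starM x y : star (x * y) = star y * star x.
Proof. exact: cstar_starM. Qed.
Lemma starD x y : star (x + y) = star x + star y.
Proof. exact: cstar_starD. Qed.
Lemma starZ (c : R[i]) x : star (c *: x) = c^* *: star x.
Proof. exact: cstar_starZ. Qed.
Lemma star1 : star 1 = 1 :> B.
Proof. by have := starM (star 1) 1; rewrite mulr1 !starK mulr1. Qed.
Lemma starN x : star (- x) = - star x.
Proof. by rewrite -scaleN1r starZ rmorphN1 scaleN1r. Qed.
Lemma starB x y : star (x - y) = star x - star y.
Proof. by rewrite starD starN. Qed.
Lemma star0 : star 0 = 0 :> B.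
Proof. by have := starB 0 0; rewrite !subrr. Qed.

(* Real scalars and the imaginary unit are embedded as central elements, so that
   identities of [B] with scalar coefficients are identities in a ring. *)
Definition sc t : B := t%:C%C%:A.
Definition ii : B := ('i : R[i])%:A.

Lemma scD s t : sc (s + t) = sc s + sc t.
Proof. by rewrite /sc rmorphD scalerDl. Qed.
Lemma scN t : sc (- t) = - sc t.
Proof. by rewrite /sc rmorphN scaleNr. Qed.
Lemma scB s t : sc (s - t) = sc s - sc t.
Proof. by rewrite scD scN. Qed.
Lemma scM s t : sc (s * t) = sc s * sc t.
Proof. by rewrite /sc rmorphM -scalerAl mul1r scalerA. Qed.
Lemma sc1 : sc 1 = 1. Proof. by rewrite /sc rmorph1 scale1r. Qed.
Lemma scC t x : x * sc t = sc t * x.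
Proof. by rewrite /sc -scalerAl -scalerAr mulr1 mul1r. Qed.
Lemma star_sc t : star (sc t) = sc t.
Proof. by rewrite /sc starZ star1 conj_Creal// complex_real. Qed.
Lemma iiC x : x * ii = ii * x.
Proof. by rewrite /ii -scalerAl -scalerAr mulr1 mul1r. Qed.
Lemma sqr_ii : ii * ii = -1.
Proof. by rewrite /ii -scalerAl mul1r scalerA -expr2 sqrCi scaleN1r. Qed.
Lemma star_ii : star ii = - ii.
Proof. by rewrite /ii starZ star1 conjCi scaleNr. Qed.

(** The norm of [B] takes values in [R[i]]; this is the same norm with values in the ordered field
    [R], where [lra] and [nra] apply. *)
Definition nr x : R := complex.Re `|x|.

Lemma normE x : `|x| = (nr x)%:C%C.
Proof. by rewrite /nr RRe_real// ger0_real. Qed.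

Lemma nr_ge0 x : 0 <= nr x. Proof. by rewrite -ler0c -normE. Qed.
Lemma nr0 : nr 0 = 0. Proof. by rewrite /nr normr0. Qed.
Lemma nr_eq0 x : nr x = 0 -> x = 0.
Proof. by move=> x0; apply: normr0_eq0; rewrite normE x0. Qed.
Lemma nrN x : nr (- x) = nr x. Proof. by rewrite /nr normrN. Qed.
Lemma nrD x y : nr (x + y) <= nr x + nr y.
Proof. by rewrite -lecR rmorphD/= -!normE; exact: ler_normD. Qed.
Lemma nrB x y : nr (x - y) <= nr x + nr y.
Proof. by rewrite -[nr y]nrN; exact: nrD. Qed.
Lemma nrC x y : nr (x - y) = nr (y - x).
Proof. by rewrite -nrN opprB. Qed.
Lemma nrM x y : nr (x * y) <= nr x * nr y.
Proof. by rewrite -lecR rmorphM/= -!normE; exact: cstar_norm_mul. Qed.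
Lemma nr_star_mul x : nr (star x * x) = nr x * nr x.
Proof.
apply: complexI; rewrite rmorphM/= -!normE -expr2.
exact: cstar_norm_star_mul.
Qed.
Lemma nr1 : nr 1 = 1.
Proof.
have := nr_star_mul 1; rewrite star1 mulr1 => n1.
have : nr 1 != 0 by apply/eqP => /nr_eq0/eqP; rewrite oner_eq0.
by move=> n0; apply: (mulfI n0); rewrite mulr1 -n1.
Qed.
Lemma nr_sc t x : nr (sc t * x) = `|t| * nr x.
Proof.
apply: complexI; rewrite rmorphM/= -!normE /sc -scalerAl mul1r normrZ.
by rewrite normc_def /= expr0n addr0 sqrtr_sqr.
Qed.
Lemma nrsc t : nr (sc t) = `|t|.
Proof. by rewrite -[sc t]mulr1 nr_sc nr1 mulr1. Qed.
Lemma nr_star x : nr (star x) = nr x.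
Proof.
suff le_star u : nr u <= nr (star u).
  by apply/eqP; rewrite eq_le -{2}(starK x) !le_star.
have [->|] := eqVneq (nr u) 0; first exact: nr_ge0.
move=> u0; have u_gt0 : 0 < nr u by rewrite lt_def u0 nr_ge0.
by rewrite -(ler_pM2r u_gt0) -nr_star_mul; exact: nrM.
Qed.

Lemma nr_sqr a : star a = a -> nr (a * a) = nr a * nr a.
Proof. by move=> sa; rewrite -nr_star_mul sa. Qed.

(** * Limits and square roots *)

Lemma geometric_cauchy (u : nat -> B) (C d : R) : 0 <= d < 1 ->
  (forall n, nr (u n.+1 - u n) <= C * d ^+ n) ->
  exists l, forall e : R, 0 < e ->
    exists N, forall n, (N <= n)%N -> nr (l - u n) <= e.
Proof.
move=> /andP[d0 d1] uC.
have C0 : 0 <= C by have := uC 0%N; rewrite expr0 mulr1; apply: le_trans (nr_ge0 _).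
(* The geometric sum bound, multiplied by [1 - d] to avoid division. *)
have tail n m : (1 - d) * nr (u (n + m)%N - u n) <= C * d ^+ n * (1 - d ^+ m).
  elim: m => [|m IHm]; first by rewrite addn0 subrr nr0 expr0 subrr !mulr0.
  have := uC (n + m)%N; rewrite addnS exprD => um.
  have := nrD (u (n + m).+1 - u (n + m)%N) (u (n + m)%N - u n).
  rewrite addrA subrK => tri.
  have d1' : 0 <= 1 - d by lra.
  have := ler_wpM2l d1' tri; have := ler_wpM2l d1' um.
  rewrite exprS mulrDr; set A := d ^+ n in IHm *; set D := d ^+ m in IHm *.
  by lra.
have small (e : R) : 0 < e -> exists N, forall n, (N <= n)%N -> nr (u n - u N) < e.
  move=> e0.
  have /cvgrPdist_lt/(_ ((1 - d) * e / (C + 1))) :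
      (fun n => d ^+ n : R) @ \oo --> (0 : R).
    by apply: cvg_expr; rewrite ger0_norm.
  case; first by rewrite !mulr_gt0 ?invr_gt0//; lra.
  move=> N _ /(_ N (leqnn _)); rewrite /= sub0r normrN ger0_norm ?exprn_ge0//.
  rewrite ltr_pdivlMr; last lra.
  move=> dN; exists N => n Nn; have := tail N (n - N)%N; rewrite subnKC//.
  move=> /le_lt_trans tl; rewrite -(@ltr_pM2l _ (1 - d)); last lra.
  apply: tl.
  have : 0 <= C * d ^+ N * d ^+ (n - N) by rewrite !mulr_ge0 ?exprn_ge0.
  have : 0 <= d ^+ N by rewrite exprn_ge0.
  by lra.
have uc : cauchy (u @ \oo).
  apply/cauchy_exP => e e0.
  have eE : e = (complex.Re e)%:C%C by rewrite RRe_real// gtr0_real.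
  have e0' : 0 < complex.Re e by rewrite -ltcR -eE.
  have [N uN] := small _ e0'.
  exists (u N), N => // n /= Nn; rewrite -ball_normE /= normE eE ltcR nrC.
  exact: uN.
have : cvg (u @ \oo) by exact: cauchy_cvg.
move=> /cvgrPdist_le ul; exists (lim (u @ \oo)) => e e0.
have [|N _ uN] := ul e%:C%C; first by rewrite ltcR.
by exists N => n Nn; have := uN n Nn; rewrite /= normE lecR.
Qed.

Lemma nr_small_eq0 x (K : R) : (forall e : R, 0 < e -> nr x <= K * e) -> x = 0.
Proof.
move=> xK; apply: nr_eq0; apply/eqP; rewrite eq_le nr_ge0 andbT.
apply/ler_addgt0Pl => e e0; rewrite addr0.
have K0 : 0 <= K by have := xK 1 ltr01; rewrite mulr1; exact: le_trans (nr_ge0 _).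
apply: le_trans (xK (e / (K + 1)) _) _; first by rewrite divr_gt0//; lra.
by rewrite mulrCA ger_pMr// ler_pdivrMr; lra.
Qed.

(** Membership of [p] in the bicommutant of [k], which stands in for [p] being a limit of
    polynomials in [k]. *)
Definition commutes_with_commutant k p := forall z, z * k = k * z -> z * p = p * z.

(** The equation for [q] rearranges to the fixed-point equation [q = (r + q^2) / 2]. The right-hand
    side maps the ball of radius [d] to itself and is [d]-Lipschitz there, so the iterates from 0
    converge. *)
Lemma sqrt_one_sub (r : B) (d : R) : star r = r -> 0 <= d < 1 -> nr r <= d ->
  exists q, [/\ star q = q, nr q <= d, commutes_with_commutant r q &
    (1 - q) * (1 - q) = 1 - r].
Proof.
move=> sr d01 rd; have /andP[d0 d1] := d01.
pose f (x : B) := sc (2^-1) * (r + x * x).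
have nf x y : nr x <= d -> nr y <= d -> nr (f x - f y) <= d * nr (x - y).
  move=> xd yd; have -> : f x - f y = sc (2^-1) * (x * (x - y) + (x - y) * y).
    by rewrite /f; ncring.
  rewrite nr_sc ger0_norm ?invr_ge0//.
  have := nrD (x * (x - y)) ((x - y) * y).
  have := nrM x (x - y); have := nrM (x - y) y.
  have := ler_wpM2r (nr_ge0 (x - y)) xd; have := ler_wpM2l (nr_ge0 (x - y)) yd.
  by lra.
pose u n := iter n f 0.
have uS n : u n.+1 = f (u n) by [].
have ud n : nr (u n) <= d.
  elim: n => [|n IHn]; first by rewrite nr0.
  rewrite uS /f nr_sc ger0_norm ?invr_ge0//.
  have := nrD r (u n * u n); have := nrM (u n) (u n).
  have := ler_pM (nr_ge0 _) (nr_ge0 _) IHn IHn.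
  by nra.
have us n : star (u n) = u n.
  by elim: n => [|n IHn]; rewrite ?star0// uS /f starM star_sc starD starM IHn sr scC.
have uz z n : z * r = r * z -> z * u n = u n * z.
  move=> zr; elim: n => [|n IHn]; first by rewrite mulr0 mul0r.
  rewrite uS /f mulrA scC -!mulrA; congr (_ * _).
  by rewrite mulrDr mulrDl zr mulrA IHn -mulrA IHn mulrA.
have [|l ul] := @geometric_cauchy u (nr (u 1%N)) d d01.
  elim=> [|n IHn]; first by rewrite subr0 expr0 mulr1.
  rewrite exprS mulrCA; apply: le_trans (nf (u n.+1) (u n) (ud _) (ud _)) _.
  exact: ler_wpM2l.
have ld : nr l <= d.
  apply/ler_addgt0Pr => e /ul[N /(_ N (leqnn _)) lN].
  by have := nrD (l - u N) (u N); rewrite subrK; have := ud N; lra.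
exists l; split => //.
- apply: subr0_eq; apply: (@nr_small_eq0 _ 2) => e /ul[N /(_ N (leqnn _)) lN].
  have -> : star l - l = star (l - u N) - (l - u N) by rewrite starB us; ncring.
  by have := nrB (star (l - u N)) (l - u N); rewrite nr_star; lra.
- move=> z zr; apply: subr0_eq.
  apply: (@nr_small_eq0 _ (2 * nr z)) => e /ul[N /(_ N (leqnn _)) lN].
  have -> : z * l - l * z = z * (l - u N) - (l - u N) * z.
    by rewrite mulrBr mulrBl uz//; ncring.
  have := nrB (z * (l - u N)) ((l - u N) * z).
  have := nrM z (l - u N); have := nrM (l - u N) z.
  by have := ler_wpM2l (nr_ge0 z) lN; lra.
- have fl : l = f l.
    apply: subr0_eq; apply: (@nr_small_eq0 _ 2) => e /ul[N lN].
    have := lN N (leqnn _); have := lN N.+1 (leqnSn _).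
    have := nf (u N) l (ud N) ld; rewrite -uS => h h1 h2.
    have := nrD (l - u N.+1) (u N.+1 - f l); rewrite addrA subrK.
    have := ler_wpM2r (nr_ge0 (u N - l)) (ltW d1); rewrite -(nrC l) in h *.
    by lra.
  have : sc 2 * l = r + l * l.
    by rewrite {1}fl /f mulrA -scM mulfV// sc1 mul1r.
  rewrite (scD 1 1) sc1 => l2.
  have -> : r = (1 + 1) * l - l * l by rewrite l2 addrK.
  ncring.
Qed.

(* For a self-adjoint [k], [|T - k| < T] means that the spectrum of [k] is contained
   in the open interval [(0, 2T)]. *)
Definition spos k := star k = k /\ exists T, nr (sc T - k) < T.

Lemma spos_sqrt k : spos k ->
  exists p, [/\ spos p, p * p = k & commutes_with_commutant k p].
Proof.
move=> [sk [T kT]].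
have T0 : 0 < T := le_lt_trans (nr_ge0 _) kT.
have TV : T^-1 * T = 1 by rewrite mulVf ?gt_eqF.
pose r := 1 - sc T^-1 * k.
have rE : r = sc T^-1 * (sc T - k) by rewrite mulrBr -scM TV sc1.
have nr_r : nr r < 1.
  by rewrite rE nr_sc gtr0_norm ?invr_gt0// mulrC ltr_pdivrMr// mul1r.
have [||q [sq qd qr q2]] := @sqrt_one_sub r (nr r) _ _ (lexx _).
- by rewrite /r starB star1 starM star_sc sk scC.
- by rewrite nr_ge0.
have q1 : nr q < 1 := le_lt_trans qd nr_r.
pose v := Num.sqrt T; have v0 : 0 < v by rewrite sqrtr_gt0.
have v2 : v * v = T by rewrite -expr2 sqr_sqrtr// ltW.
exists (sc v * (1 - q)); split.
- split; first by rewrite starM star_sc starB star1 sq scC.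
  exists v; have -> : sc v - sc v * (1 - q) = sc v * q by ncring.
  by rewrite nr_sc gtr0_norm// gtr_pMr.
- rewrite mulrA -(mulrA (sc v)) scC mulrA -scM v2 -mulrA q2 /r.
  have -> : 1 - (1 - sc T^-1 * k) = sc T^-1 * k by ncring.
  by rewrite mulrA -scM mulrC TV sc1 mul1r.
- move=> z zk; have zr : z * r = r * z.
    by rewrite /r mulrBr mulrBl mulr1 mul1r mulrA scC -!mulrA zk.
  by rewrite mulrA scC -!mulrA; congr (_ * _); rewrite mulrBr mulrBl mulr1 mul1r qr.
Qed.

(** * The cone of strictly positive elements and its relation to the norm *)

Lemma sposD k l : spos k -> spos l -> spos (k + l).
Proof.
move=> [sk [S kS]] [sl [T lT]]; split; first by rewrite starD sk sl.
exists (S + T); rewrite scD.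
have -> : sc S + sc T - (k + l) = (sc S - k) + (sc T - l) by ncring.
by have := nrD (sc S - k) (sc T - l); lra.
Qed.

Lemma spos_shift x t : star x = x -> nr x < t -> spos (sc t + x).
Proof.
move=> sx xt; split; first by rewrite starD star_sc sx.
by exists t; have -> : sc t - (sc t + x) = - x by [ncring]; rewrite nrN.
Qed.

Lemma spos_sc t : 0 < t -> spos (sc t).
Proof. by move=> t0; rewrite -[sc t]addr0; apply: spos_shift; rewrite ?star0 ?nr0. Qed.

Lemma spos_scale t k : 0 < t -> spos k -> spos (sc t * k).
Proof.
move=> t0 [sk [T kT]]; split; first by rewrite starM star_sc sk scC.
by exists (t * T); rewrite scM -mulrBr nr_sc gtr0_norm// ltr_pM2l.
Qed.

(* [a + i b] has real part [a] and squared norm [|a^2 + b^2|]. *)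
Lemma nr_commuting_squares a b (S : R) : star a = a -> star b = b ->
  a * b = b * a -> 0 <= S -> a * a + b * b = sc S -> nr a * nr a <= S.
Proof.
move=> sa sb ab S0 abS; pose u := a + ii * b.
have su : star u = a - ii * b.
  by rewrite /u starD starM star_ii sa sb mulrN iiC.
have uu : star u * u = sc S.
  rewrite su /u -abS.
  have -> : (a - ii * b) * (a + ii * b) =
      a * a + (a * ii) * b - ii * (b * a) - ii * ((b * ii) * b) by ncring.
  rewrite !iiC.
  have -> : a * a + ii * a * b - ii * (b * a) - ii * (ii * b * b) =
      a * a + ii * (a * b - b * a) - ii * ii * (b * b) by ncring.
  by rewrite ab subrr mulr0 sqr_ii; ncring.
have nu : nr u * nr u = S by rewrite -nr_star_mul uu nrsc ger0_norm.
have ua : sc 2 * a = u + star u.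
  by rewrite su /u (scD 1 1) sc1; ncring.
have : nr a <= nr u.
  have := nrD u (star u); rewrite -ua nr_sc nr_star ger0_norm//; lra.
by move=> au; rewrite -nu; apply: ler_pM; rewrite ?nr_ge0.
Qed.

(** For [S = |a|^2 + 1], the element [S - a^2] has a square root [w] commuting with [a]. Since
    [w^2 + a^2 = S], it follows that [|S - a^2| <= S], and adding [t] makes this strict. *)
Lemma spos_sqr a t : star a = a -> 0 < t -> spos (sc t + a * a).
Proof.
move=> sa t0; pose S := nr a * nr a + 1.
have S0 : 0 < S by rewrite ltr_pwDr// mulr_ge0// nr_ge0.
have saa : star (a * a) = a * a by rewrite starM sa.
have : spos (sc S - a * a).
  by apply: spos_shift; rewrite ?starN ?saa// nrN nr_sqr// /S; lra.
move=> /spos_sqrt[w [[sw _] w2 wC]].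
have aw : a * w = w * a by apply: wC; rewrite mulrBr mulrBl scC mulrA.
have := @nr_commuting_squares w a S sw sa (esym aw) (ltW S0).
rewrite w2 subrK -nr_sqr// w2 => /(_ erefl) nS.
split; first by rewrite starD star_sc saa.
exists (S + t); rewrite scD.
have -> : sc S + sc t - (sc t + a * a) = sc S - a * a by ncring.
by lra.
Qed.

(** The square roots [p] of [t + k] and [q] of [t - k] commute with each other and with [k], and
    [k^2 + (p q)^2 = t^2]. *)
Lemma nr_le_spos k t : 0 <= t -> spos (sc t + k) -> spos (sc t - k) -> nr k <= t.
Proof.
move=> t0 kp km; have sk : star k = k.
  have [+ _] := kp; rewrite starD star_sc; exact: addrI.
have [p [[sp _] p2 pC]] := spos_sqrt kp.
have [q [[sq _] q2 qC]] := spos_sqrt km.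
have kq : k * q = q * k by apply: qC; rewrite mulrBr mulrBl scC.
have pq : q * p = p * q by apply: pC; rewrite mulrDr mulrDl scC kq.
have kk : k * p = p * k by apply: pC; rewrite mulrDr mulrDl scC.
have : nr k * nr k <= t * t.
  apply: (@nr_commuting_squares _ (p * q)) => //.
  - by rewrite starM sp sq.
  - by rewrite mulrA kk -!mulrA kq.
  - by rewrite mulr_ge0.
  - have -> : p * q * (p * q) = p * (q * p) * q by ncring.
    rewrite pq; have -> : p * (p * q) * q = (p * p) * (q * q) by ncring.
    rewrite p2 q2 scM.
    have -> : (sc t + k) * (sc t - k) =
      sc t * sc t + k * sc t - sc t * k - k * k by ncring.
    by rewrite scC; ncring.
have := nr_ge0 k; nra.
Qed.

(** * Positivity of [star x * x] *)

Lemma spos_star_mul_sum y t : 0 < t ->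
  spos (sc t + (star y * y + y * star y)).
Proof.
(* These are self-adjoint, and [a^2 + b^2] is twice [y^* y + y y^*]. *)
move=> t0; pose a := y + star y; pose b := ii * (y - star y).
have sa : star a = a by rewrite /a starD starK addrC.
have sb : star b = b.
  by rewrite /b starM star_ii starB starK mulrN iiC -mulrN opprB.
have := sposD (spos_sqr sa t0) (spos_sqr sb t0).
have -> : b * b = - ((y - star y) * (y - star y)).
  rewrite /b -mulrA [X in _ * X]mulrA iiC -mulrA mulrA sqr_ii; ncring.
move=> /(@spos_scale (2^-1) _).
have -> : sc 2^-1 * (sc t + a * a + (sc t - (y - star y) * (y - star y))) =
  (sc 2^-1 * (1 + 1)) * (sc t + (star y * y + y * star y)) by rewrite /a; ncring.
by rewrite -sc1 -scD -scM mulVf ?gt_eqF// sc1 mul1r invr_gt0; apply.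
Qed.

(* With [N = |y|^2] and [k = y y^*], the identity [k^2 + N k = y (y^* y + N) y^*]
   turns an upper bound on [y^* y] into one on [k]; since [y^* y + y y^* >= 0]
   bounds [k] from below, [|k| = N] cannot be much larger than [e]. *)
Lemma nr_le_of_spos_sub_star_mul y e : 0 < e ->
  spos (sc e - star y * y) -> nr y * nr y <= 4 * e.
Proof.
move=> e0 he; rewrite leNgt; apply/negP => eN.
set N := nr y * nr y in eN.
set h := star y * y in he; pose k := y * star y.
have sh : star h = h by rewrite /h starM starK.
have sk : star k = k by rewrite /k starM starK.
have nh : nr h = N by rewrite /h nr_star_mul.
have nk : nr k = N by rewrite /k -{1}(starK y) nr_star_mul nr_star.
(* Since [4 e < N], [h] lies below [N / 4], while [h + k] is positive up to any positive
   constant. *)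
have k_ge : spos (sc (N / 4) + k).
  have -> : sc (N / 4) + k = (sc (N / 4 - e) + (h + k)) + (sc e - h).
    by rewrite scB; ncring.
  by apply: sposD => //; apply: spos_star_mul_sum; lra.
have nhN : nr (sc N + h) <= 5 / 4 * N.
  apply: nr_le_spos; first lra.
    by rewrite addrA -scD; apply: spos_shift => //; lra.
  have -> : sc (5 / 4 * N) - (sc N + h) =
      sc (5 / 4 * N - N - e) + (sc e - h) by rewrite !scB; ncring.
  by apply: sposD => //; apply: spos_sc; lra.
(* Completing the square: [m^2 = y (N + h) y^* + N^2 / 4] has norm at most
   [3 N^2 / 2 < (5 N / 4)^2]. This bounds [k] above by [3 N / 4], and [7 / 8] leaves room for
   strictness. *)
pose m := k + sc (N / 2).
have sm : star m = m by rewrite /m starD star_sc sk.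
have mm : m * m = y * (sc N + h) * star y + sc (N / 2 * (N / 2)).
  have NE : sc N = sc (N / 2) + sc (N / 2) by rewrite -scD; congr sc; lra.
  rewrite NE /m /k /h (scM (N / 2) (N / 2)); set c := sc _.
  have -> : y * (c + c + star y * y) * star y =
      (y * c + y * c) * star y + y * (star y * y) * star y by ncring.
  have -> : (y * star y + c) * (y * star y + c) =
      y * star y * (y * star y) + y * star y * c + c * (y * star y) + c * c by ncring.
  by rewrite (scC _ (y * star y)) (scC _ y); ncring.
have nm : nr m <= 5 / 4 * N.
  have := nrD (y * (sc N + h) * star y) (sc (N / 2 * (N / 2))).
  rewrite -mm nr_sqr// nrsc ger0_norm; last by rewrite mulr_ge0//; lra.
  have := nrM (y * (sc N + h)) (star y); rewrite nr_star.
  have := ler_wpM2r (nr_ge0 y) (nrM y (sc N + h)).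
  rewrite mulrAC -/N.
  have N0 : 0 <= N by lra.
  have := ler_wpM2l N0 nhN; have := nr_ge0 m.
  nra.
have : nr k <= 7 / 8 * N.
  apply: nr_le_spos; first lra.
    have -> : sc (7 / 8 * N) + k = sc (7 / 8 * N - N / 4) + (sc (N / 4) + k).
      by rewrite addrA -scD subrK.
    by apply: sposD => //; apply: spos_sc; lra.
  have -> : sc (7 / 8 * N) - k = sc (7 / 8 * N + N / 2) + - m.
    by rewrite /m scD; ncring.
  by apply: spos_shift; rewrite ?starN ?sm// nrN; lra.
by rewrite nk; lra.
Qed.

(* Let [h = x^* x], let [g] be the square root of [h^2 + eta^2] and [z = g - h],
   which approximates twice the negative part of [h]. For [y = x z g^(1/2)] we
   have [4 y^* y = eta^4 - z^4], so the upper bound [eta^4 / 4] on [y^* y] makes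
   [y], hence [z], small, and [h = g - z] is nearly positive. *)
Lemma spos_star_mul x t : 0 < t -> spos (sc t + star x * x).
Proof.
move=> t0; set h := star x * x.
have sh : star h = h by rewrite /h starM starK.
pose eta := t / 2; have eta0 : 0 < eta by rewrite /eta; lra.
have eta20 : 0 < eta * eta by rewrite mulr_gt0.
have [g [gpos g2 gC]] := spos_sqrt (spos_sqr sh eta20).
have hg : h * g = g * h by apply: gC; rewrite mulrDr mulrDl scC mulrA.
have [p [[sp _] p2 pC]] := spos_sqrt gpos.
have sg := gpos.1.
have hp : h * p = p * h by exact: pC.
pose z := g - h; pose w := g + h; pose c := sc (eta * eta).
have sz : star z = z by rewrite /z starB sg sh.
have zp : z * p = p * z by apply: pC; rewrite /z mulrBl mulrBr hg.
have zw : z * w = c.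
  have -> : z * w = g * g - h * h + (g * h - h * g) by rewrite /z /w; ncring.
  by rewrite g2 hg subrr addr0 addrK.
pose y := x * z * p.
have yE : star y * y = z * h * (z * g).
  rewrite /y !starM sp sz.
  have -> : p * (z * star x) * (x * z * p) = (p * z) * h * z * p.
    by rewrite /h; ncring.
  rewrite -zp; have -> : z * p * h * z * p = z * (p * h) * z * p by ncring.
  rewrite -hp; have -> : z * (h * p) * z * p = z * h * (p * z) * p by ncring.
  by rewrite -zp -p2; ncring.
(* Here [2 h = w - z] and [2 g = w + z]. *)
have y4 : sc 4 * (star y * y) = c * c - (z * z) * (z * z).
  have -> : sc 4 = (1 + 1) * (1 + 1) by rewrite -sc1 -scD -scM; congr sc; lra.
  have -> : (1 + 1) * (1 + 1) * (star y * y) =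
      (z * w - z * z) * (z * w + z * z) by rewrite yE /w /z; ncring.
  rewrite zw; have -> : (c - z * z) * (c + z * z) =
      c * c - (z * z) * (z * z) + (c * (z * z) - (z * z) * c) by ncring.
  by rewrite (scC _ (z * z) : z * z * c = _) subrr addr0.
have yE4 : star y * y = sc 4^-1 * (c * c - (z * z) * (z * z)).
  by rewrite -y4 mulrA -scM mulVf ?gt_eqF// sc1 mul1r.
set E := eta * eta * (eta * eta).
have E0 : 0 < E by rewrite mulr_gt0.
(* Taking [E / 2] instead of the sharp bound [E / 4] leaves the positive constant that [spos_sqr]
   requires. *)
have ny : nr y * nr y <= 4 * (E / 2).
  apply: nr_le_of_spos_sub_star_mul; first lra.
  pose a := sc 2^-1 * (z * z).
  have sa : star a = a by rewrite /a !starM sz star_sc scC.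
  have -> : sc (E / 2) - star y * y = sc (E / 4) + a * a.
    have -> : a * a = sc 4^-1 * ((z * z) * (z * z)).
      have -> : (4^-1 : R) = 2^-1 * 2^-1 by lra.
      rewrite /a mulrA -(mulrA _ (z * z)) scC !mulrA -scM -!mulrA; ncring.
    have -> : E / 2 = E / 4 + 4^-1 * E by lra.
    by rewrite yE4 scD (scM 4^-1) (scM (eta * eta)) -/c; ncring.
  by apply: spos_sqr => //; lra.
(* [z^4 = eta^4 - 4 y^* y] has norm at most [9 eta^4 < (2 eta)^4]. *)
have nz : nr z <= 2 * eta.
  have zz : (z * z) * (z * z) = c * c - sc 4 * (star y * y).
    by rewrite y4; ncring.
  have := nrB (c * c) (sc 4 * (star y * y)).
  rewrite -zz nr_sc nr_star_mul -scM nrsc !gtr0_norm// nr_sqr ?nr_sqr//; last first.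
    by rewrite starM sz.
  have := nr_ge0 z; set n := nr z; move=> n0 nE.
  rewrite leNgt; apply/negP => en.
  have n2 : 4 * (eta * eta) < n * n by nra.
  have : 16 * E < n * n * (n * n) by rewrite /E; nra.
  by rewrite -/E in nE; lra.
have [_ [T gT]] := gpos.
split; first by rewrite starD star_sc sh.
exists (T + t); rewrite scD.
have -> : sc T + sc t - (sc t + h) = (sc T - g) + z by rewrite /z; ncring.
by have := nrD (sc T - g) z; rewrite /eta in nz *; lra.
Qed.

(** Both [x^* x] and its negative [k] are positive up to any [e > 0], so the norm of [x^* x] is at
    most [e]. *)
Lemma star_mul_add_eq0 x k : (forall t, 0 < t -> spos (sc t + k)) ->
  star x * x + k = 0 -> x = 0.
Proof.
move=> kpos /eqP; rewrite addr_eq0 => /eqP xk.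
suff xx : star x * x = 0.
  apply: nr_eq0; apply/eqP; rewrite -[_ == _]orbb -mulf_eq0 -nr_star_mul xx.
  by rewrite nr0.
apply: (@nr_small_eq0 _ 1) => e e0; rewrite mul1r; apply: nr_le_spos (ltW e0) _ _.
  exact: spos_star_mul.
by rewrite xk opprK; exact: kpos.
Qed.

(** Ordinary positivity, obtained as the closure of the strict cone. *)
Definition positive k := forall t, 0 < t -> spos (sc t + k).

Lemma positiveD k l : positive k -> positive l -> positive (k + l).
Proof.
move=> kn ln t t0.
have -> : sc t + (k + l) = (sc (t / 2) + k) + (sc (t / 2) + l).
  by rewrite [t in LHS]splitr scD; ncring.
by apply: sposD; [apply: kn|apply: ln]; lra.
Qed.

Lemma positive_sc t : positive (sc t) -> 0 <= t.
Proof.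
move=> tn; apply/ler_addgt0Pl => e /tn[_ [T]].
by rewrite -scD -scB nrsc ltr_norml => /andP[]; lra.
Qed.

(** * Completely positive summands of the identity *)

Lemma CP_gram (phi : B -> B) x : CP phi -> exists p0 p1 q0 q1 : B,
  [/\ phi 1 = star p0 * p0 + star p1 * p1,
      phi x = star p0 * q0 + star p1 * q1,
      phi (star x) = star q0 * p0 + star q1 * p1 &
      phi (star x * x) = star q0 * q0 + star q1 * q1].
Proof.
move=> [_ phiP].
(* With rows [(1, x)] and [(0, 0)], [Y^* Y] is the Gram matrix of [1, x]. The columns of a factor
   [Z] of its image supply the [p] and the [q]. *)
pose Y : 'M[B]_2 := \matrix_(i, j) if i == 0 then (if j == 0 then 1 else x) else 0.
have [|Z /matrixP ZE] := phiP 2%N (mxstar Y *m Y); first by exists Y.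
have {}ZE i j : phi (star (Y 0 i) * Y 0 j) =
    star (Z 0 i) * Z 0 j + star (Z 1 i) * Z 1 j.
  have := ZE i j; rewrite !mxE !big_ord_recl !big_ord0 !mxE /= !addr0.
  have -> : lift ord0 ord0 = 1 :> 'I_2 by apply: val_inj.
  by rewrite star0 !mul0r addr0.
exists (Z 0 0), (Z 1 0), (Z 0 1), (Z 1 1); rewrite -!ZE !mxE /=.
by rewrite star1 !mul1r mulr1.
Qed.

Lemma CP_summand_id_mul (theta omega : B -> B) x : CP theta -> CP omega ->
  theta + omega = (fun y => y) ->
  theta x = theta 1 * x /\ theta (star x) = star x * theta 1.
Proof.
move=> tcp ocp to.
have toE y : theta y + omega y = y by rewrite -[RHS](congr1 (@^~ y) to).
have [p0 [p1 [q0 [q1 [t1 tx tsx txx]]]]] := CP_gram x tcp.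
have [r0 [r1 [s0 [s1 [w1 wx wsx wxx]]]]] := CP_gram x ocp.
(* The row [(p, q)] of a factor applied to the column [(x, -1)]. *)
pose v (p q : B) := p * x - q.
have vv p q : star (v p q) * v p q = star x * (star p * p) * x -
    star x * (star p * q) - star q * p * x + star q * q.
  by rewrite /v starB starM; ncring.
have sum0 : star (v p0 q0) * v p0 q0 + (star (v p1 q1) * v p1 q1 +
    (star (v r0 s0) * v r0 s0 + star (v r1 s1) * v r1 s1)) = 0.
  transitivity (star x * (theta 1 + omega 1) * x - star x * (theta x + omega x)
    - (theta (star x) + omega (star x)) * x +
    (theta (star x * x) + omega (star x * x))).
    by rewrite !vv t1 tx tsx txx w1 wx wsx wxx; ncring.
  by rewrite !toE; ncring.
have nn y : positive (star y * y) by move=> t; exact: spos_star_mul.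
have v0 : v p0 q0 = 0.
  by apply: star_mul_add_eq0 sum0; do ?apply: positiveD.
have v1 : v p1 q1 = 0.
  by move: sum0; rewrite addrCA; apply: star_mul_add_eq0; do ?apply: positiveD.
rewrite tsx tx t1 -(subr0_eq v0) -(subr0_eq v1) !starM.
by split; ncring.
Qed.

Lemma CP_one_positive (phi : B -> B) : CP phi -> positive (phi 1).
Proof.
move=> /(CP_gram 1)[p0 [p1 [_ [_ [-> _ _ _]]]]].
by apply: positiveD => t; exact: spos_star_mul.
Qed.

Lemma CP_id : CP (fun x : B => x).
Proof.
split=> // n X [Y XY]; exists Y; rewrite -XY.
by apply/matrixP => i j; rewrite mxE.
Qed.

Lemma CP_summand_id_scalar (theta omega : B -> B) :
  @centre R B = [set c%:A | c in [set: R[i]]] ->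
  CP theta -> CP omega -> theta + omega = (fun y => y) ->
  exists2 s : R, 0 <= s & theta = s%:C%C *: (fun y => y).
Proof.
move=> cB tcp ocp to.
have tmul x := (CP_summand_id_mul x tcp ocp to).
(* Both products with [x] equal [theta x]; for the right-hand one, the second identity is taken at
   [star x]. *)
have : @centre R B (theta 1).
  by move=> x; rewrite -(tmul x).1 -[x in LHS]starK (tmul (star x)).2 starK.
rewrite cB => -[c _ c1].
have nn1 := CP_one_positive tcp.
have st1 : star (theta 1) = theta 1.
  by have [+ _] := nn1 1 ltr01; rewrite starD star_sc; exact: addrI.
have cr : c = (complex.Re c)%:C%C.
  rewrite RRe_real//; apply/CrealP.
  move/eqP: st1; rewrite -c1 starZ star1 -subr_eq0 -scalerBl scaler_eq0 oner_eq0.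
  by rewrite orbF subr_eq0 => /eqP.
exists (complex.Re c).
  by apply: positive_sc; rewrite /sc -cr c1.
by apply/funext => x; rewrite (tmul x).1 -c1 -cr -scalerAl mul1r.
Qed.

End CStar.

Theorem lemma3p1 (R : realType) (B : cstarAlgType R) :
  is_AWstar_factor B -> pure_CP (fun x : B => x).
Proof.
move=> [_ cB]; split=> [|theta omega tcp ocp to]; first exact: CP_id.
have [s s0 thE] := CP_summand_id_scalar cB tcp ocp to.
have [|s' s'0 omE] := CP_summand_id_scalar cB ocp tcp; first by rewrite addrC.
(* Evaluation at 1 gives [s + s' = 1] inside [B], and the norm carries this back to [R].
   Nonnegativity of [s'] then yields [s <= 1]. *)
have ss' : s' = 1 - s.
  apply/eqP; rewrite -(subr_eq0 s') -normr_eq0 -(nrsc B) scB scB sc1.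
  have := congr1 (@^~ 1) to; rewrite thE omE -!/(sc _ _) => <-.
  by rewrite addrAC subrr add0r subrr nr0.
exists s; split => //.
- by rewrite s0; lra.
- by rewrite -ss'.
Qed.
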